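(* Let $\lambda$ be an admissible capacity on an interval $I$ and let $x,x_0\in\overline I$. Let $X$ be a Brownian burglar of intensity $\nu\in\mathbb{R}$ and initial capacity $\lambda$, starting from $x$ and targeting $x_0$. Let $g$ be a stretching morphism from $\lambda$ to another admissible capacity $\rho$ on some interval $J$. Then the process $(g(X_t))_{t\ge0}$ is (up to time-change) a Brownian burglar of intensity $\nu$ and initial capacity $\rho$, starting from $g(x)$ and targeting $g(x_0)$.
   Context: **Capacities.** Open intervals $I\subset\mathbb{R}$ may be unbounded; $\overline I=I\cup\{\inf I,\sup I\}$ and $\overline{\mathbb{R}}=\mathbb{R}\cup\{\pm\infty\}$. A capacity on $I$ is a continuous $\lambda:I\to(0,\infty)$. It is admissible if for some (hence all) $c\in I$, $\int_{\inf I}^c du/\lambda(u)=\int_c^{\sup I}du/\lambda(u)=+\infty$. A stretching morphism from an admissible capacity $\lambda$ on $I$ to an admissible capacity $\rho$ on $J$ is an increasing diffeomorphism $g:I\to J$ with $g'(x)=\rho(g(x))/\lambda(x)$ for all $x\in I$, extended to $\overline I\to\overline J$. The signed indicator is $\mathbbm{1}_{(a,b)}(y)=\mathbf 1_{\{a<y<b\}}-\mathbf 1_{\{b<y<a\}}$ (endpoints possibly infinite). All processes are geometric paths, considered up to time-reparametrization. **Burglar driver.** For $\nu\in\mathbb{R}$, $z,z_0\in\overline{\mathbb{R}}$, the burglar driver of parameter $\nu$ started from $z$ and targeting $z_0$ is the continuous diffusion $D$ on $\overline{\mathbb{R}}$ with $D_0=z$ and $dD_t=e^{\cosh(D_t)}dB_t+e^{2\cosh(D_t)}(1-\nu)\,\mathrm{sign}(D_t-z_0)\,dt$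 ($B$ a standard Brownian motion), instantly reflected at $\pm\infty$. If $z_0=\pm\infty$ it is stopped at $T(D)=\inf\{t:D_t=z_0\}$; otherwise $T(D)=+\infty$. **Brownian burglar.** Let $\lambda_0$ be admissible on $I$ and $x,x_0\in\overline I$. Let $g_0$ be any stretching morphism from $\lambda_0$ to the constant capacity $1$ on $\mathbb{R}$, $z_0=g_0(x_0)$, and $D$ the burglar driver of parameter $\nu$ started from $g_0(x)$ and targeting $z_0$. For $y\in I$ let $g_t(y)$ solve $g_t(y)=g_0(y)+\int_0^t\mathbbm{1}_{(z_0,g_s(y))}(D_s)\,d[D]_s$ until $T(y)=\inf\{t:g_t(y)=\pm\infty\}$; then $g_t$ is an increasing $C^1$-diffeomorphism from $I_t=\{y:T(y)>t\}$ to $\mathbb{R}$, extended to $\overline{I_t}\to\overline{\mathbb{R}}$. The Brownian burglar of parameter (intensity) $\nu$, initial capacity $\lambda_0$, started from $x$ and targeting $x_0$ is the process $X_t=g_t^{-1}(D_t)\in\overline{I_t}$, with final time $T(X)=T(D)$, defined up to time-change. Its law does not depend on the choice of $g_0$. *)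

(* Defs.v *)
From HB Require Import structures.
From mathcomp Require Import all_boot all_order all_algebra.
From mathcomp Require Import all_classical all_reals all_analysis.
From mathcomp Require Import measurable_realfun.

Set Implicit Arguments.
Unset Strict Implicit.
Unset Printing Implicit Defensive.

Import Order.TTheory GRing.Theory Num.Theory.
Import numFieldNormedType.Exports.

Local Open Scope classical_set_scope.
Local Open Scope ring_scope.

Section Capacities.
Context {R : realType}.
Implicit Types (I J : set R) (lam rho g h : R -> R).

Definition open_interval I := [/\ open I, is_interval I & I !=set0].

Definition einf I : \bar R := ereal_inf (EFin @` I).
Definition esup I : \bar R := ereal_sup (EFin @` I).

Definition iclosure I : set (\bar R) := EFin @` I `|` [set einf I; esup I].

Definition capacity I lam :=
  (forall u, I u -> {for u, continuous lam}) /\ (forall u, I u -> 0 < lam u).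

Definition admissible I lam :=
  [/\ open_interval I, capacity I lam &
   exists2 c, I c &
     (\int[lebesgue_measure]_(u in I `&` `]-oo, c]) ((lam u)^-1)%:E = +oo)%E /\
     (\int[lebesgue_measure]_(u in I `&` `[c, +oo[) ((lam u)^-1)%:E = +oo)%E].

(* Used on open sets only, where [derive1 f] is the genuine derivative. *)
Definition C1_on I (f : R -> R) := forall u, I u ->
  derivable f u 1 /\ {for u, continuous (derive1 f)}.

Definition increasing_diffeo I J g :=
  [/\ {homo g : u v / I u /\ I v /\ u < v >-> u < v},
      C1_on I g &
      exists h, [/\ forall u, I u -> J (g u) /\ h (g u) = u,
                    forall v, J v -> I (h v) /\ g (h v) = v &
                    C1_on J h]].

Definition stretching_morphism I lam J rho g :=
  increasing_diffeo I J g /\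
  forall u, I u -> derive1 g u = rho (g u) / lam u.

(* Extension of an increasing bijection g : I -> J to the closures in \bar R;
   the value outside [iclosure I] is irrelevant. *)
Definition extend I J g (p : \bar R) : \bar R :=
  if `[< (EFin @` I) p >] then (g (fine p))%:E
  else if p == esup I then esup J else einf J.

(* The signed indicator 1_(a,b)(y). *)
Definition signed_indic (a b y : \bar R) : R :=
  ((a < y < b)%E)%:R - ((b < y < a)%E)%:R.

(* sign(y - a), with sign 0 = 0; meaningful for infinite a too. *)
Definition sign_from (a y : \bar R) : R := ((a < y)%E)%:R - ((y < a)%E)%:R.

Definition cosh (u : R) : R := (expR u + expR (- u)) / 2.

End Capacities.

Section Paths.
Context {R : realType}.

(* Time domain of a path of duration T: [0, T[, or the single instant 0 when
   T = 0. *)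
Definition lifespan (T : \bar R) : set R :=
  [set t | 0 <= t /\ (t = 0 \/ (t%:E < T)%E)].

(* The two paths of durations T and T' are time changes of one another. *)
Definition same_geometric_path (T : \bar R) (X : R -> \bar R)
    (T' : \bar R) (X' : R -> \bar R) :=
  exists theta : R -> R,
    [/\ set_bij (lifespan T) (lifespan T') theta,
        {homo theta : s t / lifespan T s /\ lifespan T t /\ s < t >-> s < t} &
        forall t, lifespan T t -> X t = X' (theta t)].

(* The k-th point of the uniform subdivision of [a, b] in n+1 pieces. *)
Definition subdiv (a b : R) (n k : nat) : R := a + (b - a) * k%:R / n.+1%:R.

End Paths.

Section StochasticCalculus.
Context {R : realType} {d : measure_display} {Omega : measurableType d}.
Variable P : probability Omega R.
Implicit Types (F : R -> set (set Omega)) (D : R -> Omega -> \bar R).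

Definition filtration F :=
  [/\ forall t : R, 0 <= t -> sigma_algebra setT (F t),
      forall t : R, 0 <= t -> F t `<=` measurable &
      forall s t : R, 0 <= s -> s <= t -> F s `<=` F t].

Definition adapted F d' (E : measurableType d') (Y : R -> Omega -> E) :=
  forall t : R, 0 <= t -> forall U, measurable U -> F t (Y t @^-1` U).

(* The last clause says both that B_t - B_s is independent of F_s and that it
   is centered Gaussian with variance t - s. *)
Definition brownian_motion F (B : R -> Omega -> R) :=
  [/\ adapted F B,
      {ae P, forall w, B 0 w = 0},
      forall w, {within `[0, +oo[, continuous (fun t => B t w)} &
      forall s t : R, 0 <= s -> s < t ->
        forall A (U : set (measurableTypeR R)), F s A -> measurable U ->
          P (A `&` [set w | U (B t w - B s w)]) =
          (P A * normal_prob 0 (Num.sqrt (t - s)%R) U)%E].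

Definition cvg_in_prob_on (E : set Omega) (Y : nat -> Omega -> R)
    (Z : Omega -> R) :=
  forall eps : R, 0 < eps ->
    P (E `&` [set w | eps < `|Y n w - Z w|]) @[n --> \oo] --> 0%E.

(* On the event E, on which s |-> H_s is continuous on [a, b], the Ito integral
   of the adapted process H against B over [a, b] is Z: it is the limit in
   probability of the left-point Riemann sums. *)
Definition ito_integral_on (E : set Omega) (H B : R -> Omega -> R) (a b : R)
    (Z : Omega -> R) :=
  cvg_in_prob_on E
    (fun n w => \sum_(k < n.+1) H (subdiv a b n k) w *
                  (B (subdiv a b n k.+1) w - B (subdiv a b n k) w)) Z.

Definition real_on D (a b : R) : set Omega :=
  [set w | forall s, a <= s <= b -> D s w \is a fin_num].

Definition hitting_time (z0 : \bar R) (Y : R -> \bar R) : \bar R :=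
  ereal_inf (EFin @` [set t | 0 <= t /\ Y t = z0]).

(* The final time T(D). *)
Definition driver_time (z0 : \bar R) D (w : Omega) : \bar R :=
  if z0 \is a fin_num then +oo%E else hitting_time z0 (D ^~ w).

(* Weak solutions.  The equation is required over the time intervals on which D
   is real. Instantaneous reflection at -oo and +oo means that D is a
   continuous process in \bar R spending no time (in Lebesgue measure) at the
   two boundary points, apart from the target if the latter is infinite: D is
   then stopped there. *)
Definition burglar_driver (nu : R) (z z0 : \bar R) D :=
  exists F (B : R -> Omega -> R),
    [/\ filtration F /\ adapted F D /\ brownian_motion F B,
        (forall w, {within `[0, +oo[, continuous (fun t => D t w)}) /\
          {ae P, forall w, D 0 w = z},
        forall a b : R, 0 <= a -> a < b ->
          ito_integral_on (real_on D a b)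
            (fun s w => expR (cosh (fine (D s w)))) B a b
            (fun w => fine (D b w) - fine (D a w) -
               \int[lebesgue_measure]_(s in `[a, b])
                 (expR (2 * cosh (fine (D s w))) * (1 - nu) *
                  sign_from z0 (D s w))),
        {ae P, forall w, lebesgue_measure
          [set t | 0 <= t /\ (t%:E < driver_time z0 D w)%E /\
                   D t w \isn't a fin_num] = 0%E} &
        {ae P, forall w (t : R), 0 <= t -> (driver_time z0 D w <= t%:E)%E ->
          D t w = z0}].

(* d[D] as a random measure on the time axis.  As D may visit -oo and +oo, the
   quadratic variation is that of D over the time intervals on which D is real,
   and d[D] puts no mass on the times at which D is infinite. *)
Definition bracket D (Q : R.-ker Omega ~> measurableTypeR R) :=
  (forall a b : R, 0 <= a -> a < b ->
     {ae P, forall w, real_on D a b w -> Q w [set` `]a, b]] \is a fin_num} /\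
     cvg_in_prob_on (real_on D a b)
       (fun n w => \sum_(k < n.+1)
          (fine (D (subdiv a b n k.+1) w) - fine (D (subdiv a b n k) w)) ^+ 2)
       (fun w => fine (Q w [set` `]a, b]]))) /\
  {ae P, forall w,
    Q w [set t | 0 <= t /\ D t w \isn't a fin_num] = 0%E}.

End StochasticCalculus.

Section Burglar.
Context {R : realType}.
Implicit Types (I : set R) (D : R -> \bar R).

(* A flow line t |-> g_t(y), as a path in \bar R. *)
Definition explosion_time (G : R -> \bar R) : \bar R :=
  ereal_inf (EFin @` [set t | 0 <= t /\ G t \isn't a fin_num]).

(* The flow line is unconstrained after its explosion time; continuity in
   \bar R forces G to tend to -oo or +oo at that time. *)
Definition flow_line (z0 : \bar R) D (Q : {measure set (measurableTypeR R) -> \bar R})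
    (c : R) (G : R -> \bar R) :=
  [/\ {within `[0, +oo[, continuous G},
      G 0 = c%:E &
      forall t : R, 0 <= t -> (t%:E < explosion_time G)%E ->
        (G t = c%:E + \int[Q]_(s in `]0%R, t]) (signed_indic z0 (G s) (D s))%:E)%E].

Definition unburgled I (G : R -> R -> \bar R) (t : R) : set R :=
  [set y | I y /\ (t%:E < explosion_time (G ^~ y))%E].

Definition flow_map (G : R -> R -> \bar R) (t : R) : R -> R :=
  fun y => fine (G t y).

(* X is the path t |-> g_t^-1(D_t) of duration T, where g_t is extended to the
   closure of I_t. *)
Definition burglar_path I (g0 : R -> R) (z0 : \bar R) D
    (Q : {measure set (measurableTypeR R) -> \bar R}) (T : \bar R)
    (X : R -> \bar R) :=
  exists G : R -> R -> \bar R,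
    (forall y, I y -> flow_line z0 D Q (g0 y) (G ^~ y)) /\
    (forall t, lifespan T t ->
       [/\ increasing_diffeo (unburgled I G t) setT (flow_map G t),
           iclosure (unburgled I G t) (X t) &
           extend (unburgled I G t) setT (flow_map G t) (X t) = D t]).

(* X, with (random) duration zeta, is up to time-change a Brownian burglar. *)
Definition brownian_burglar {d : measure_display} {Omega : measurableType d}
    (P : probability Omega R) (nu : R) I (lam : R -> R) (x x0 : \bar R)
    (zeta : Omega -> \bar R) (X : R -> Omega -> \bar R) :=
  [/\ measurable_fun setT zeta,
      forall t : R, 0 <= t -> measurable_fun [set w | lifespan (zeta w) t] (X t) &
      exists (g0 : R -> R) (D : R -> Omega -> \bar R)
             (Q : R.-ker Omega ~> measurableTypeR R),
        let z0 := extend I setT g0 x0 in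
        [/\ stretching_morphism I lam setT (fun=> 1) g0,
            burglar_driver P nu (extend I setT g0 x) z0 D,
            bracket P D Q &
            {ae P, forall w, exists Y : R -> \bar R,
               burglar_path I g0 z0 (D ^~ w) (Q w) (driver_time z0 D w) Y /\
               same_geometric_path (zeta w) (X ^~ w)
                                   (driver_time z0 D w) Y}]].

End Burglar.

(* Main.v *)
Require Import Defs.
From mathcomp Require Import all_boot all_order all_algebra.
From mathcomp Require Import all_classical all_reals all_analysis.
From mathcomp Require Import measurable_realfun.

Set Implicit Arguments.
Unset Strict Implicit.
Unset Printing Implicit Defensive.

Import Order.TTheory GRing.Theory Num.Theory.
Import numFieldNormedType.Exports.

Local Open Scope classical_set_scope.
Local Open Scope ring_scope.

(** The Brownian burglar sees its capacity only through the stretching morphism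
    g0 that sends it to the constant capacity 1, so a stretching morphism g can
    be absorbed into the choice of g0.  Let h be the inverse of g.

    Stretching morphisms form a groupoid: h stretches rho to lam
    ([stretching_morphism_inv]) and g0 \o h stretches rho to 1
    ([stretching_morphism_comp]).  The latter is therefore an admissible choice
    for the capacity rho, and it sends g x to g0 x and g x0 to g0 x0.  Hence
    the very same driver D, with the same bracket Q, drives both burglars.

    For this driver the flow line issued from v in J is the flow line issued
    from h v in I.  The new flow at time t is g_t \o h, with domain g(I_t), and
    the burglar path g_t^-1(D_t) becomes its image under g
    ([burglar_path_transport]).  As the transport acts on each path separately,
    the time change is unchanged as well.

    What requires an argument is the boundary: the point X_t may be an endpoint
    of I_t, and the formula for X_t uses the extension of g_t to the closure of
    I_t, whereas the image burglar uses the extension of g to the closure of I.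
    On the closure of I_t the latter is also the extension of g restricted to
    I_t, because the extension of g is an order isomorphism between the
    closures of I and J, hence preserves suprema and infima of subsets
    ([extend_subset]). *)

(** * Increasing diffeomorphisms *)

Section Diffeomorphisms.
Context {R : realType}.
Implicit Types (I J K S : set R) (lam rho kap f g h : R -> R).

Lemma C1_on_continuous I f u : C1_on I f -> I u -> {for u, continuous f}.
Proof.
move=> fI /fI[df _].
exact/differentiable_continuous/derivable1_diffP.
Qed.

Lemma C1_onS I J f : I `<=` J -> C1_on J f -> C1_on I f.
Proof. by move=> IJ fJ u /IJ /fJ. Qed.

(** Openness of I makes the chain rule hold near each point, which is what the
    continuity of the derivative of the composite depends on. *)
Lemma C1_on_comp I J g f : open I -> (forall u, I u -> J (g u)) ->
  C1_on I g -> C1_on J f -> C1_on I (f \o g).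
Proof.
move=> oI gIJ gI fJ u Iu.
have [dg cg] := gI _ Iu.
have [df cf] := fJ _ (gIJ _ Iu).
split.
  move/derivable1_diffP: dg => dg; move/derivable1_diffP: df => df.
  exact/derivable1_diffP/(differentiable_comp dg df).
have chain v : I v -> derive1 (f \o g) v = derive1 f (g v) * derive1 g v.
  move=> Iv; have [dgv _] := gI _ Iv; have [dfv _] := fJ _ (gIJ _ Iv).
  exact: derive1_comp dgv dfv.
have cgu : {for u, continuous g} := C1_on_continuous gI Iu.
rewrite /prop_for /continuous_at chain//.
have cfg : derive1 f (g v) @[v --> u] --> derive1 f (g u).
  exact: (@continuous_comp _ _ _ g (derive1 f) u cgu cf).
move=> U /(cvgM cfg cg).
apply: filterS2 (open_nbhs_nbhs (conj oI Iu)) => v Iv.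
by rewrite /= chain.
Qed.

Definition mutually_inverse I J g h :=
  (forall u, I u -> J (g u) /\ h (g u) = u) /\
  (forall v, J v -> I (h v) /\ g (h v) = v).

Lemma mutually_inverse_sym I J g h :
  mutually_inverse I J g h -> mutually_inverse J I h g.
Proof. by case. Qed.

Lemma increasing_diffeo_inv I J g : increasing_diffeo I J g ->
  exists2 h, mutually_inverse I J g h & increasing_diffeo J I h.
Proof.
move=> [gmono gC1 [h [gK hK hC1]]]; exists h => //; split => //; last by exists g.
move=> v w [Jv [Jw vw]].
have [Ihv ghv] := hK _ Jv.
have [Ihw ghw] := hK _ Jw.
rewrite ltNge le_eqVlt; apply/negP => /orP[/eqP hwv|hwv].
  by move: vw; rewrite -ghv -ghw hwv ltxx.
have := gmono _ _ (conj Ihw (conj Ihv hwv)).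
by rewrite ghv ghw => /(lt_trans vw); rewrite ltxx.
Qed.

Lemma increasing_diffeo_le I J g u v : increasing_diffeo I J g ->
  I u -> I v -> u <= v -> g u <= g v.
Proof.
move=> [gmono _ _] Iu Iv; rewrite le_eqVlt => /predU1P[-> //|uv].
exact/ltW/gmono.
Qed.

(** Near u in I, the inverse h maps a small interval around g u, contained in J,
    onto an interval around u, by the intermediate value theorem; its values
    belong to I.  In particular the domain of the flow at each time is open, as
    the flow maps it onto the whole line. *)
Lemma increasing_diffeo_open I J g :
  increasing_diffeo I J g -> open J -> open I.
Proof.
move=> gdiff oJ; have [h [gK hK] [hmono hC1 _]] := increasing_diffeo_inv gdiff.
rewrite openE => u Iu; have [Jgu hgu] := gK _ Iu.
have /nbhs_ballP[e/= e0 eJ] := open_nbhs_nbhs (conj oJ Jgu).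
have e2 : 0 < e / 2 by rewrite divr_gt0.
have itvJ c : c \in `[g u - e / 2, g u + e / 2] -> J c.
  move=> c_itv; apply: eJ; rewrite /ball/= distrC.
  apply: (@le_lt_trans _ _ (e / 2)); first by rewrite ler_distl.
  by rewrite ltr_pdivrMr// ltr_pMr// ltr1n.
have JL : J (g u - e / 2).
  by apply: itvJ; rewrite in_itv/= lexx/= lerD2l ge0_cp// ltW.
have JR : J (g u + e / 2).
  by apply: itvJ; rewrite in_itv/= lexx andbT lerD2l ge0_cp// ltW.
have hL : h (g u - e / 2) < u.
  by rewrite -[ltRHS]hgu; apply: hmono; split=> //; split=> //; rewrite gtrBl.
have hR : u < h (g u + e / 2).
  by rewrite -[ltLHS]hgu; apply: hmono; split=> //; split=> //; rewrite ltrDl.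
have u_itv : u \in `](h (g u - e / 2)), (h (g u + e / 2))[.
  by rewrite in_itv/= hL hR.
apply: filterS (near_in_itvoo u_itv).
move=> w; rewrite in_itv/= => /andP[Lw wR].
have hLR := ltW (lt_trans hL hR).
have [|||c /itvJ Jc <-] := @IVT _ h (g u - e / 2) (g u + e / 2) w.
- by rewrite lerD2l ge0_cp// ltW.
- apply: continuous_in_subspaceT => c; rewrite inE/= => c_itv.
  by apply: C1_on_continuous hC1 _; apply: itvJ.
- by rewrite min_l// max_r// !ltW.
by case: (hK _ Jc).
Qed.

Lemma increasing_diffeo_comp I J K g f : open K ->
  increasing_diffeo I J g -> increasing_diffeo J K f ->
  increasing_diffeo I K (f \o g).
Proof.
move=> oK gdiff fdiff.
have oI := increasing_diffeo_open gdiff (increasing_diffeo_open fdiff oK).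
case: gdiff => gmono gC1 [h [gK hK hC1]].
case: fdiff => fmono fC1 [k [fK kK kC1]].
split.
- move=> u v [Iu [Iv uv]]; have [Jgu _] := gK _ Iu; have [Jgv _] := gK _ Iv.
  by apply: fmono; do 2?[split=> //]; apply: gmono.
- by apply: C1_on_comp gC1 fC1 => // u /gK[].
exists (h \o k); split=> [u Iu|v Kv|].
- have [Jgu hgu] := gK _ Iu; have [Kfgu kfgu] := fK _ Jgu.
  by rewrite /= kfgu.
- have [Jkv fkv] := kK _ Kv; have [Ihkv ghkv] := hK _ Jkv.
  by rewrite /= ghkv.
- by apply: C1_on_comp kC1 hC1 => // v /kK[].
Qed.

Lemma increasing_diffeo_restrict I J g h S : mutually_inverse I J g h ->
  increasing_diffeo J I h -> S `<=` I ->
  increasing_diffeo (J `&` h @^-1` S) S h.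
Proof.
move=> [gK hK] [hmono hC1 [k [hK' kK kC1]]] SI; split.
- by move=> u v [[Ju _] [[Jv _] uv]]; exact: hmono.
- by apply: (C1_onS _ hC1) => v [].
exists k; split=> [v [Jv Sv]|u Su|].
- by have [] := hK' _ Jv.
- by have [Jk hk] := kK _ (SI _ Su); split=> //; split=> //=; rewrite hk.
- exact: C1_onS SI kC1.
Qed.

(** Differentiating g (h v) = v gives h' v = (g' (h v))^-1, and
    g' (h v) = rho v / lam (h v). *)
Lemma stretching_morphism_inv I lam J rho g h : open J ->
  capacity I lam -> capacity J rho ->
  stretching_morphism I lam J rho g ->
  mutually_inverse I J g h -> increasing_diffeo J I h ->
  stretching_morphism J rho I lam h.
Proof.
move=> oJ [_ lam0] [_ rho0] [[_ gC1 _] g'] [_ hK] hdiff; split=> // v Jv.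
have [Ihv ghv] := hK _ Jv.
have [_ hC1 _] := hdiff.
have : derive1 (g \o h) v = 1.
  have ghid : {near v, g \o h =1 id}.
    by apply: filterS (open_nbhs_nbhs (conj oJ Jv)) => w /hK[].
  by rewrite derive1E (near_eq_derive _ ghid) derive_id.
have [dh _] := hC1 _ Jv; have [dg _] := gC1 _ Ihv.
rewrite (derive1_comp dh dg) g'// ghv => eq1.
have rho_v := lt0r_neq0 (rho0 _ Jv); have lam_v := lt0r_neq0 (lam0 _ Ihv).
have rl : rho v / lam (h v) != 0 by rewrite mulf_neq0// invr_neq0.
by apply: (mulfI rl); rewrite eq1 mulrA divfK// divff.
Qed.

Lemma stretching_morphism_comp I lam J rho K kap g f : open K ->
  (forall v, J v -> rho v != 0) ->
  stretching_morphism I lam J rho g -> stretching_morphism J rho K kap f ->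
  stretching_morphism I lam K kap (f \o g).
Proof.
move=> oK rho0 [gdiff g'] [fdiff f'].
split; first exact: increasing_diffeo_comp gdiff fdiff.
case: gdiff => _ gC1 [? [gK _ _]]; case: fdiff => _ fC1 _ u Iu.
have [Jgu _] := gK _ Iu.
have [dg _] := gC1 _ Iu; have [df _] := fC1 _ Jgu.
by rewrite (derive1_comp dg df) f'// g'// mulrA divfK// rho0.
Qed.

End Diffeomorphisms.

(** * Extension to the endpoints *)

Section Extension.
Context {R : realType}.
Implicit Types (I J K S : set R) (f g h : R -> R) (p q : \bar R).

(** Without extreme points, the three clauses defining [extend] are mutually
    exclusive. *)
Definition endless I :=
  [/\ I !=set0, ~ (EFin @` I) (esup I) & ~ (EFin @` I) (einf I)].

Lemma esup_ub I u : I u -> (u%:E <= esup I)%E.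
Proof. by move=> Iu; apply: ereal_sup_ubound; exists u. Qed.

Lemma einf_lb I u : I u -> (einf I <= u%:E)%E.
Proof. by move=> Iu; apply: ereal_inf_lbound; exists u. Qed.

Lemma open_endless I : open I -> I !=set0 -> endless I.
Proof.
move=> oI I0; split=> // -[u Iu uE];
  have /nbhs_ballP[e/= e0 eI] := open_nbhs_nbhs (conj oI Iu);
  have e2 : 0 < e / 2 by rewrite divr_gt0.
- have /esup_ub : I (u + e / 2).
    apply: eI; rewrite /ball/= opprD addNKr normrN gtr0_norm//.
    by rewrite ltr_pdivrMr// ltr_pMr// ltr1n.
  by rewrite -uE lee_fin gerDl leNgt e2.
- have /einf_lb : I (u - e / 2).
    apply: eI; rewrite /ball/= subKr gtr0_norm//.
    by rewrite ltr_pdivrMr// ltr_pMr// ltr1n.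
  by rewrite -uE lee_fin lerBrDr gerDl leNgt e2.
Qed.

Lemma endless_neq I : endless I -> einf I != esup I.
Proof.
move=> [[u Iu] nsup ninf]; apply/eqP => eq_ends; apply: nsup; exists u => //.
by apply/eqP; rewrite eq_le esup_ub//= -eq_ends einf_lb.
Qed.

Lemma extend_fin I J g u : I u -> extend I J g u%:E = (g u)%:E.
Proof. by move=> Iu; rewrite /extend asboolT//; exists u. Qed.

Lemma extend_esup I J g : endless I -> extend I J g (esup I) = esup J.
Proof. by move=> [_ nsup _]; rewrite /extend asboolF// eqxx. Qed.

Lemma extend_einf I J g : endless I -> extend I J g (einf I) = einf J.
Proof.
move=> eI; have [_ _ ninf] := eI.
by rewrite /extend asboolF// (negbTE (endless_neq eI)).
Qed.

Lemma iclosure_ind I (Pr : \bar R -> Prop) :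
  (forall u, I u -> Pr u%:E) -> Pr (esup I) -> Pr (einf I) ->
  forall p, iclosure I p -> Pr p.
Proof. by move=> PI Psup Pinf p [[u Iu <-]|[->|->]]; [apply: PI| |]. Qed.

Lemma eq_extend I J f g p : (forall u, I u -> f u = g u) ->
  extend I J f p = extend I J g p.
Proof.
move=> fg; rewrite /extend; case: asboolP => // -[u Iu <-] /=.
by rewrite fg.
Qed.

Lemma extend_comp I J K g f p : endless I -> endless J ->
  (forall u, I u -> J (g u)) -> iclosure I p ->
  extend J K f (extend I J g p) = extend I K (f \o g) p.
Proof.
move=> eI eJ gIJ; move: p; apply: iclosure_ind => [u Iu||].
- by rewrite !extend_fin//; apply: gIJ.
- by rewrite !extend_esup.
- by rewrite !extend_einf.
Qed.

Lemma extend_id I p : endless I -> iclosure I p -> extend I I id p = p.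
Proof.
move=> eI; move: p; apply: iclosure_ind => [u Iu||].
- by rewrite extend_fin.
- by rewrite extend_esup.
- by rewrite extend_einf.
Qed.

Lemma extend_iclosure I J g p : endless I -> (forall u, I u -> J (g u)) ->
  iclosure I p -> iclosure J (extend I J g p).
Proof.
move=> eI gIJ; move: p; apply: iclosure_ind => [u Iu||].
- by rewrite extend_fin//; left; exists (g u) => //; apply: gIJ.
- by rewrite extend_esup//; right; right.
- by rewrite extend_einf//; right; left.
Qed.

Lemma iclosure_bounds I p : I !=set0 -> iclosure I p ->
  (einf I <= p <= esup I)%E.
Proof.
move=> [u0 Iu0]; have le_ends := le_trans (einf_lb Iu0) (esup_ub Iu0).
move: p; apply: iclosure_ind => [u Iu||]; last 2 first.
- by rewrite le_ends lexx.
- by rewrite le_ends lexx.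
- by rewrite einf_lb// esup_ub.
Qed.

Lemma iclosure_interval I p : is_interval I ->
  (einf I <= p <= esup I)%E -> iclosure I p.
Proof.
move=> itvI /andP[]; rewrite le_eqVlt => /predU1P[<-|infp]; first by right; left.
rewrite le_eqVlt => /predU1P[->|psup]; first by right; right.
have [_ [u Iu <-] up] := ereal_inf_lt infp.
have [_ [v Iv <-] pv] := ereal_sup_gt psup.
left; case: p up pv {infp psup} => // r; rewrite !lte_fin => ur rv.
by exists r => //; apply: (itvI u v) => //; rewrite !ltW.
Qed.

(** The extension of g is defined at the endpoints of S because those endpoints
    never leave the closure of the interval I. *)
Lemma iclosure_ends_subset I S : is_interval I -> S `<=` I -> S !=set0 ->
  iclosure I (esup S) /\ iclosure I (einf S).
Proof.
move=> itvI SI [u Su]; have Iu := SI _ Su.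
split; apply: iclosure_interval => //; apply/andP; split.
- exact: le_trans (einf_lb Iu) (esup_ub Su).
- by apply: ge_ereal_sup => _ [v /SI Iv <-]; exact: esup_ub.
- by apply: le_ereal_inf_tmp => _ [v /SI Iv <-]; exact: einf_lb.
- exact: le_trans (einf_lb Su) (esup_ub Iu).
Qed.

Lemma extend_le I J g p q : endless I -> increasing_diffeo I J g ->
  iclosure I p -> iclosure I q -> (p <= q)%E ->
  (extend I J g p <= extend I J g q)%E.
Proof.
move=> eI gdiff Ip Iq; have [I0 nsup ninf] := eI.
have gIJ u : I u -> J (g u) by case: gdiff => _ _ [? [gK _ _]] /gK[].
have J0 : J !=set0 by case: I0 => u /gIJ; exists (g u).
have /andP[q_inf q_sup] := iclosure_bounds J0 (extend_iclosure eI gIJ Iq).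
have /andP[infq qsup] := iclosure_bounds I0 Iq.
case: Ip => [[u Iu <-]|[->|->]] pq.
- case: Iq => [[v Iv vq]|[qinf|->]].
  + rewrite -vq !extend_fin// lee_fin; apply: increasing_diffeo_le gdiff _ _ _ => //.
    by rewrite -lee_fin vq.
  + case: ninf; exists u => //; apply/eqP.
    by rewrite eq_le einf_lb// andbT -qinf.
  + by rewrite extend_fin// extend_esup// esup_ub//; apply: gIJ.
- by rewrite extend_einf.
- suff -> : q = esup I by [].
  by apply/eqP; rewrite eq_le qsup.
Qed.

Lemma extendK I J g h p : endless I -> endless J -> mutually_inverse I J g h ->
  iclosure I p -> extend J I h (extend I J g p) = p.
Proof.
move=> eI eJ [gK _] Ip; rewrite extend_comp//; last by move=> u /gK[].
by rewrite -[RHS](extend_id eI)//; apply: eq_extend => u /gK[].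
Qed.

(** Extending g to the closure of I and then restricting to the closure of S is
    the same as extending the restriction of g to S.  Only the endpoints of S
    matter.  The extensions of g and h are nondecreasing and inverse to each
    other, so esup S, which lies in the closure of I, is sent to the supremum
    of the image of S; likewise for the infimum. *)
Lemma extend_subset I J g h S p : open_interval I -> open_interval J ->
  mutually_inverse I J g h ->
  increasing_diffeo I J g -> increasing_diffeo J I h ->
  endless S -> S `<=` I -> iclosure S p ->
  extend I J g p = extend S (J `&` h @^-1` S) g p.
Proof.
move=> [oI itvI I0] [oJ itvJ J0] gh gdiff hdiff eS SI.
have eI := open_endless oI I0; have eJ := open_endless oJ J0.
have [gK hK] := gh; have [S0 _ _] := eS.
set S' := J `&` _.
have S'g u : S u -> S' (g u).
  by move=> Su; have [Jgu hgu] := gK _ (SI _ Su); split; rewrite //= hgu.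
have S'J : S' `<=` J by move=> v [].
have S'0 : S' !=set0 by case: S0 => u /S'g; exists (g u).
have [Isup Iinf] := iclosure_ends_subset itvI SI S0.
have [Jsup Jinf] := iclosure_ends_subset itvJ S'J S'0.
have hIJ v : J v -> I (h v) by move=> /hK[].
have gJI u : I u -> J (g u) by move=> /gK[].
have hsup := extend_iclosure eJ hIJ Jsup.
have hinf := extend_iclosure eJ hIJ Jinf.
have hg q := extendK eJ eI (mutually_inverse_sym gh) (p := q).
move: p; apply: iclosure_ind => [u Su||].
- by rewrite !extend_fin//; apply: SI.
- rewrite (extend_esup _ _ eS); apply/eqP; rewrite eq_le; apply/andP; split.
  + rewrite -[leRHS]hg//; apply: extend_le => //.
    apply: ge_ereal_sup => _ [u Su <-]; have [Jgu hgu] := gK _ (SI _ Su).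
    rewrite -hgu -(extend_fin I h Jgu).
    by apply: extend_le => //; [left; exists (g u)|apply/esup_ub/S'g].
  + apply: ge_ereal_sup => _ [v [Jv Shv] <-]; have [Ihv ghv] := hK _ Jv.
    rewrite -ghv -(extend_fin J g Ihv).
    by apply: extend_le => //; [left; exists (h v)|apply: esup_ub].
- rewrite (extend_einf _ _ eS); apply/eqP; rewrite eq_le; apply/andP; split.
  + apply: le_ereal_inf_tmp => _ [v [Jv Shv] <-]; have [Ihv ghv] := hK _ Jv.
    rewrite -ghv -(extend_fin J g Ihv).
    by apply: extend_le => //; [left; exists (h v)|apply: einf_lb].
  + rewrite -[leLHS]hg//; apply: extend_le => //.
    apply: le_ereal_inf_tmp => _ [u Su <-]; have [Jgu hgu] := gK _ (SI _ Su).
    rewrite -hgu -(extend_fin I h Jgu).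
    by apply: extend_le => //; [left; exists (g u)|apply/einf_lb/S'g].
Qed.

Lemma measurable_extend I J g : open I -> C1_on I g ->
  measurable_fun setT (extend I J g).
Proof.
move=> oI gC1.
have mI : measurable (EFin @` I) by apply: measurable_image_EFin; exact: open_measurable.
apply: measurable_fun_if => //.
- apply: (@measurable_fun_bool _ _ _ _ true).
  rewrite setTI (_ : _ @^-1` _ = EFin @` I)//.
  by apply/seteqP; split=> p /= /asboolP.
- rewrite setTI (_ : _ @^-1` _ = EFin @` I); last first.
    by apply/seteqP; split=> p /= /asboolP.
  apply: measurableT_comp => //.
  apply: (measurable_comp (F := I)).
  + exact: open_measurable.
  + by move=> _ [_ [u Iu <-] <-].
  + apply: open_continuous_measurable_fun => // u; rewrite inE => Iu.
    exact: C1_on_continuous gC1 Iu.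
  + exact: fine_measurable.
- rewrite setTI; apply: measurable_funTS.
  apply: measurable_fun_ifT => //.
  exact: measurable_fun_eqe.
Qed.

End Extension.

(** * Transport of Brownian burglars *)

Section Transport.
Context {R : realType}.
Implicit Types (I J : set R) (g h : R -> R).

(** Applied to f = g0, this is why the change of initial map leaves the starting
    point and the target of the driver where they were. *)
Lemma extend_conj I J g h f p : open_interval I -> open_interval J ->
  mutually_inverse I J g h -> iclosure I p ->
  extend J setT (f \o h) (extend I J g p) = extend I setT f p.
Proof.
move=> [oI _ I0] [oJ _ J0] [gK _] Ip.
rewrite extend_comp//; [|exact: open_endless|exact: open_endless|by move=> u /gK[]].
by apply: eq_extend => u /gK[_ /= ->].
Qed.

(** Conjugating the flow G by h: the flow lines issued from J are among those
    issued from I, so the driver and its bracket are kept. *)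
Lemma burglar_path_transport I J g h (g0 : R -> R) z0 (D : R -> \bar R)
    (Q : {measure set (measurableTypeR R) -> \bar R}) T (Y : R -> \bar R) :
  open_interval I -> open_interval J -> mutually_inverse I J g h ->
  increasing_diffeo I J g -> increasing_diffeo J I h ->
  burglar_path I g0 z0 D Q T Y ->
  burglar_path J (g0 \o h) z0 D Q T (extend I J g \o Y).
Proof.
move=> opI opJ gh gdiff hdiff [G [Gflow Gpath]].
have [gK hK] := gh.
exists (fun t v => G t (h v)); split=> [v Jv|t tT].
  by apply: Gflow; case: (hK _ Jv).
have [fdiff IY YD] := Gpath _ tT.
set It := unburgled I G t in fdiff IY YD.
have -> : unburgled J (fun t v => G t (h v)) t = J `&` h @^-1` It.
  apply/seteqP; split=> v.
    by move=> [Jv Tv]; split=> //; split=> //; case: (hK _ Jv).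
  by move=> [Jv [_ Tv]].
have ItI : It `<=` I by move=> u [].
have oIt : open It := increasing_diffeo_open fdiff openT.
have It0 : It !=set0.
  by have [_ _ [k [_ kK _]]] := fdiff; have [] := kK 0 Logic.I; exists (k 0).
have eIt := open_endless oIt It0.
set Jt := J `&` h @^-1` It.
have htdiff : increasing_diffeo Jt It h := increasing_diffeo_restrict gh hdiff ItI.
have gJt u : It u -> Jt (g u).
  by move=> Itu; have [Jgu hgu] := gK _ (ItI _ Itu); split; rewrite //= hgu.
have oJt := increasing_diffeo_open htdiff oIt.
have eJt : endless Jt by apply: open_endless => //; case: It0 => u /gJt; exists (g u).
(* Y t lies in the closure of It, so g may be extended from It, the domain of
   the flow map, instead of from I. *)
rewrite [(_ \o _) t]/= (extend_subset opI opJ gh gdiff hdiff eIt ItI IY) -/Jt.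
split.
- exact: increasing_diffeo_comp openT htdiff fdiff.
- exact: extend_iclosure IY.
- rewrite extend_comp// -YD; apply: eq_extend => u /ItI /gK[_ hgu].
  by rewrite /= /flow_map hgu.
Qed.

End Transport.

Theorem proposition3p1 (R : realType) (d : measure_display)
    (Omega : measurableType d) (P : probability Omega R)
    (nu : R) (I J : set R) (lam rho g : R -> R) (x x0 : \bar R)
    (zeta : Omega -> \bar R) (X : R -> Omega -> \bar R) :
  admissible I lam -> iclosure I x -> iclosure I x0 ->
  brownian_burglar P nu I lam x x0 zeta X ->
  admissible J rho ->
  stretching_morphism I lam J rho g ->
  brownian_burglar P nu J rho (extend I J g x) (extend I J g x0)
    zeta (fun t w => extend I J g (X t w)).
Proof.
move=> [opI capI _] Ix Ix0 [mzeta mX [g0 [D [Q [g0_str DB brQ XY]]]]].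
move=> [opJ capJ _] g_str.
have [oI _ _] := opI; have [oJ _ _] := opJ; have [gdiff _] := g_str.
have [h gh hdiff] := increasing_diffeo_inv gdiff.
split=> // [t t0|].
  apply: measurableT_comp (mX t t0).
  by apply: measurable_extend => //; case: gdiff.
(* The images of x and x0 under g0 \o h and g are those under g0, so that the
   conditions on the driver are literally the same. *)
exists (g0 \o h), D, Q; rewrite /= !(extend_conj _ opI opJ gh)//; split=> //.
- have h_str := stretching_morphism_inv oJ capI capJ g_str gh hdiff.
  apply: stretching_morphism_comp h_str g0_str; first exact: openT.
  by move=> u /(proj2 capI)/lt0r_neq0.
- apply: filterS XY => w [Y [Ypath [theta [bij mono XYtheta]]]].
  exists (extend I J g \o Y); split; first exact: burglar_path_transport Ypath.
  by exists theta; split=> // t tT; rewrite /= XYtheta.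
Qed.
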